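(* Let $r\geq2$ be an integer and $p\geq1$. If $G$ is a $K_{r+1}$-free graph of order $n$, then \[\lambda^{(p)}(G)\leq\left(1-\frac1r\right)^{1/p}\left(2e(G)\right)^{1-1/p}\] and \[\lambda^{(p)}(G)\leq\left(1-\frac1r\right)n^{2-2/p}.\] If $p>1$, equality holds in the second inequality if and only if $r\mid n$ and $G=T_r(n)$.
   Context: For a graph $G$ with vertex set $\{1,\dots,n\}$ and real $p\geq1$, the $p$-spectral radius is $\lambda^{(p)}(G)=\max\{2\sum_{\{i,j\}\in E(G)}x_ix_j : x_1,\dots,x_n\in\mathbb{R},\ |x_1|^p+\cdots+|x_n|^p=1\}$. $e(G)$ is the number of edges of $G$. $T_r(n)$ denotes the complete $r$-partite graph of order $n$ whose parts have sizes $\lfloor n/r\rfloor$ or $\lceil n/r\rceil$. *)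

(* Defs.v *)
From mathcomp Require Import all_boot all_order all_algebra.
From mathcomp Require Import all_classical all_reals all_analysis.

Set Implicit Arguments.
Unset Strict Implicit.
Unset Printing Implicit Defensive.

Import Order.TTheory GRing.Theory Num.Theory.
Import numFieldNormedType.Exports.

Local Open Scope classical_set_scope.
Local Open Scope ring_scope.

Record graph (n : nat) := Graph {
  adj : rel 'I_n;
  adj_sym : symmetric adj;
  adj_irrefl : irreflexive adj }.

(* Each edge {i, j} is encoded once, as the pair (i, j) with i < j. *)
Definition edges (n : nat) (G : graph n) : {set 'I_n * 'I_n} :=
  [set ij : 'I_n * 'I_n | (ij.1 < ij.2)%N && adj G ij.1 ij.2]%SET.

Definition num_edges (n : nat) (G : graph n) : nat := #|edges G|.

Lemma complete_sym (m : nat) : symmetric (fun i j : 'I_m => i != j).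
Proof. by move=> i j; rewrite eq_sym. Qed.

Lemma complete_irrefl (m : nat) : irreflexive (fun i j : 'I_m => i != j).
Proof. by move=> i; rewrite eqxx. Qed.

Definition complete (m : nat) : graph m :=
  Graph (@complete_sym m) (@complete_irrefl m).

Definition subgraph_of (m n : nat) (H : graph m) (G : graph n) : Prop :=
  exists f : 'I_m -> 'I_n,
    injective f /\ forall i j, adj H i j -> adj G (f i) (f j).

(* H-freeness; the subgraph is not required to be induced. *)
Definition free_of (m n : nat) (H : graph m) (G : graph n) : Prop :=
  ~ subgraph_of H G.

(* G is (isomorphic to) the Turan graph T_r(n): [part] assigns to each vertex
   its part. For n < r the floor is 0, so some parts are empty. *)
Definition is_turan (r n : nat) (G : graph n) : Prop :=
  exists part : 'I_n -> 'I_r,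
    (forall i j, adj G i j = (part i != part j)) /\
    (forall c : 'I_r,
       #|[set i | part i == c]%SET| = (n %/ r)%N \/
       #|[set i | part i == c]%SET| = ((n + r.-1) %/ r)%N).

Definition edge_form (R : realType) (n : nat) (G : graph n) (x : 'rV[R]_n) : R :=
  2 * \sum_(ij in edges G) x ord0 ij.1 * x ord0 ij.2.

Definition p_sphere (R : realType) (n : nat) (p : R) : set 'rV[R]_n :=
  [set x | \sum_(i < n) `|x ord0 i| `^ p = 1].

(* The supremum is a maximum when 0 < n and 1 <= p: see
   [p_spectral_radius_max]. For n = 0 the sphere is empty and the value is 0. *)
Definition p_spectral_radius (R : realType) (n : nat) (p : R) (G : graph n) : R :=
  sup (edge_form G @` p_sphere p).

Lemma continuous_bigsum (R : realType) (T : topologicalType) (I : Type) (s : seq I)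
    (P : pred I) (F : I -> T -> R) :
  (forall i, continuous (F i)) ->
  continuous (fun x => \sum_(i <- s | P i) F i x).
Proof.
move=> cF x; elim: s => [|i s IH].
  under eq_fun do rewrite big_nil; exact: cst_continuous.
under eq_fun do rewrite big_cons; case: (P i) => //.
by apply: cvgD => //; exact: cF.
Qed.

Lemma continuous_normpowR (R : realType) (p : R) :
  0 < p -> continuous (fun a : R => `|a| `^ p).
Proof.
move=> p0 a; have [->|a0] := eqVneq a 0.
  apply/cvgrPdist_lt => e e0; near=> b.
  rewrite normr0 powR0 ?gt_eqF// sub0r normrN ger0_norm ?powR_ge0//.
  have -> : e = (e `^ p^-1) `^ p.
    by rewrite -powRrM mulVf ?gt_eqF// powRr1// ltW.
  apply: gt0_ltr_powR; rewrite ?nnegrE ?powR_ge0//.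
  near: b; apply: cvgr0_norm_lt; last exact: powR_gt0.
  exact: cvg_id.
have na0 : 0 < `|a| by rewrite normr_gt0.
have /= := @continuous_comp R^o R^o R^o Num.norm (fun b : R => b `^ p) a.
apply; first exact: norm_continuous.
by apply/differentiable_continuous/derivable1_diffP; apply: derivable_powR;
  rewrite in_itv/= na0.
Unshelve. all: by end_near. Qed.

Lemma compact_p_sphere (R : realType) (n : nat) (p : R) :
  1 <= p -> compact (p_sphere p : set 'rV[R]_n).
Proof.
move=> p1; have p0 : 0 < p by exact: lt_le_trans p1.
apply: bounded_closed_compact.
  exists 1; split; first exact: num_real.
  move=> M M1 x xS; rewrite /Num.norm /= mx_normrE; apply: bigmax_le => [|[k i] _ /=].
    by rewrite ltW// (lt_trans _ M1).
  rewrite (le_trans _ (ltW M1))// ord1 leNgt; apply/negP => xi.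
  have : 1 < \sum_(j < n) `|x ord0 j| `^ p.
    rewrite (bigD1 i)//= (lt_le_trans (y := `|x ord0 i| `^ p))//.
      by rewrite (lt_le_trans xi)// le1r_powR// ltW.
    by rewrite lerDl sumr_ge0// => j _; exact: powR_ge0.
  by rewrite xS ltxx.
apply: (@preimage_closed _ _ (fun x : 'rV[R]_n => \sum_(i < n) `|x ord0 i| `^ p)
  [set y | y = 1]); last exact: closed_eq.
move=> x _; apply: continuous_bigsum => i y.
have /= := @continuous_comp 'rV[R]_n R R (fun x => x ord0 i)
  (fun a : R => `|a| `^ p) y.
apply; first exact: coord_continuous.
exact: continuous_normpowR.
Qed.

Lemma p_spectral_radius_max (R : realType) (n : nat) (p : R) (G : graph n) :
  (0 < n)%N -> 1 <= p ->
  exists2 x : 'rV[R]_n, p_sphere p x &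
    edge_form G x = p_spectral_radius p G /\
    forall y, p_sphere p y -> edge_form G y <= edge_form G x.
Proof.
move=> n0 p1; have p0 : 0 < p by exact: lt_le_trans p1.
have S0 : (p_sphere p : set 'rV[R]_n) !=set0.
  exists (delta_mx ord0 (Ordinal n0)).
  rewrite /p_sphere /= (bigD1 (Ordinal n0))//= big1 ?addr0.
    by rewrite mxE !eqxx normr1 powR1.
  by move=> i /negPf ni; rewrite mxE ni andbF normr0 powR0// gt_eqF.
have cf : {within p_sphere p, continuous (edge_form G : 'rV[R]_n -> R)}.
  apply: continuous_subspaceT => x; rewrite /edge_form.
  apply: (@cvgM _ _ (nbhs x) _ (fun=> 2)); first exact: cvg_cst.
  apply: continuous_bigsum => ij y.
  apply: (@cvgM _ _ (nbhs y) _ (fun z : 'rV[R]_n => z ord0 ij.1) (fun z => z ord0 ij.2)).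
    exact: (@coord_continuous R 1 n ord0 ij.1 y).
  exact: (@coord_continuous R 1 n ord0 ij.2 y).
have [x /set_mem xS xmax] := EVT_max_rV S0 (compact_p_sphere p1) cf.
have ub y : p_sphere p y -> edge_form G y <= edge_form G x.
  by move=> yS; apply/xmax/mem_set.
exists x => //; split => //; apply/eqP; rewrite eq_le; apply/andP; split.
  apply: ub_le_sup; last by exists x.
  by exists (edge_form G x) => _ [y /ub ? <-].
apply: ge_sup; first by exists (edge_form G x), x.
by move=> _ [y /ub ? <-].
Qed.

(* Main.v *)
(* The power mean inequality over the ordered pairs (i, j) of adjacent vertices
   bounds the sum of the x_i x_j by (2e)^(1-1/p) times the 1/p-th power of the sum
   of the y_i y_j, where y_i = |x_i|^p has total weight 1. By Motzkin-Straus the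
   latter sum is at most 1 - 1/r. Motzkin-Straus at the uniform weight gives
   2e <= (1 - 1/r) n^2, hence the second bound. If p > 1, equality there makes the
   uniform weight a maximizer of the Motzkin-Straus form; perturbing it shows that
   G is regular and that non-adjacency is transitive, so the classes of
   non-adjacent vertices are r parts of size n/r. *)
Require Import Defs.
From mathcomp Require Import all_boot all_order all_algebra.
From mathcomp Require Import all_classical all_reals all_analysis.
From mathcomp Require Import ring lra.

Set Implicit Arguments.
Unset Strict Implicit.
Unset Printing Implicit Defensive.

Import Order.TTheory GRing.Theory Num.Theory.

Local Open Scope ring_scope.

(** * The quadratic form of a weighted graph and its variations *)

Definition nbr_sum (R : pzRingType) (T : finType) (e : rel T) (y : T -> R) (i : T) : R :=
  \sum_j (e i j)%:R * y j.

(** The quadratic form of the adjacency matrix: ordered pairs count each edge twice, like the factor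
    2 in [edge_form]. For symmetric [e], [nbr_sum] is half its gradient. *)
Definition edge_sum (R : pzRingType) (T : finType) (e : rel T) (y : T -> R) : R :=
  \sum_i y i * nbr_sum e y i.

Lemma sum_delta (R : pzRingType) (T : finType) (i : T) (F : T -> R) :
  \sum_k (k == i)%:R * F k = F i.
Proof.
rewrite (bigD1 i)//= eqxx mul1r big1 ?addr0// => k /negPf ->.
by rewrite mul0r.
Qed.

Section WeightedGraph.
Variables (R : realFieldType) (T : finType) (e : rel T).
Hypotheses (e_sym : symmetric e) (e_irr : irreflexive e).
Implicit Types (y v : T -> R) (s : R) (i j k : T).

Lemma nbr_sumD y v i :
  nbr_sum e (fun k => y k + v k) i = nbr_sum e y i + nbr_sum e v i.
Proof. by rewrite /nbr_sum -big_split /=; apply: eq_bigr => j _; rewrite mulrDr. Qed.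

Lemma sum_nbr_sum y v : \sum_i y i * nbr_sum e v i = \sum_i v i * nbr_sum e y i.
Proof.
rewrite /nbr_sum; under eq_bigr do rewrite mulr_sumr.
rewrite exchange_big /=; apply: eq_bigr => i _; rewrite mulr_sumr.
by apply: eq_bigr => j _; rewrite (e_sym j); ring.
Qed.

Lemma edge_sumD y v :
  edge_sum e (fun k => y k + v k) =
  edge_sum e y + 2 * (\sum_k v k * nbr_sum e y k) + edge_sum e v.
Proof.
rewrite /edge_sum; under eq_bigr do rewrite nbr_sumD mulrDl !mulrDr.
rewrite !big_split /= (sum_nbr_sum y v); ring.
Qed.

Lemma nbr_sumZ s y i : nbr_sum e (fun k => s * y k) i = s * nbr_sum e y i.
Proof. by rewrite /nbr_sum mulr_sumr; apply: eq_bigr => j _; rewrite mulrCA. Qed.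

Lemma edge_sumZ s y : edge_sum e (fun k => s * y k) = s ^+ 2 * edge_sum e y.
Proof.
rewrite /edge_sum mulr_sumr; apply: eq_bigr => i _; rewrite nbr_sumZ; ring.
Qed.

(** Irreflexivity removes the diagonal terms of the second variation. For non-adjacent i and j the
    change is therefore linear in s, which [motzkin_straus] exploits. *)
Lemma edge_sum_transfer y s i j :
  edge_sum e (fun k => y k + s * ((k == i)%:R - (k == j)%:R)) =
  edge_sum e y + 2 * s * (nbr_sum e y i - nbr_sum e y j) - 2 * s ^+ 2 * (e i j)%:R.
Proof.
have sumB (F : T -> R) : \sum_k ((k == i)%:R - (k == j)%:R) * F k = F i - F j.
  under eq_bigr do rewrite mulrBl.
  by rewrite sumrB !sum_delta.
rewrite edge_sumD edge_sumZ {2}/edge_sum sumB.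
under eq_bigr do rewrite -mulrA.
rewrite -mulr_sumr sumB.
have nbrB k : nbr_sum e (fun k => (k == i)%:R - (k == j)%:R) k = (e k i)%:R - (e k j)%:R :> R.
  rewrite /nbr_sum; under eq_bigr do rewrite mulrC mulrBl.
  by rewrite sumrB !sum_delta.
rewrite !nbrB !e_irr (e_sym j i) /=; ring.
Qed.

Lemma sum_transfer y s i j :
  \sum_k (y k + s * ((k == i)%:R - (k == j)%:R)) = \sum_k y k.
Proof.
rewrite big_split -mulr_sumr sumrB /=.
have sum1 (l : T) : \sum_k (k == l)%:R = 1 :> R.
  by have /= := sum_delta l (fun=> 1 : R); under eq_bigr do rewrite mulr1.
by rewrite !sum1 subrr mulr0 addr0.
Qed.

(** * The Motzkin-Straus inequality *)

Lemma sqr_sum_le (A : {set T}) (r : nat) y : (#|A| <= r)%N -> (0 < r)%N ->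
  (forall i, i \notin A -> y i = 0) ->
  r%:R^-1 * (\sum_i y i) ^+ 2 <= \sum_i y i ^+ 2.
Proof.
move=> Ar r0 yA; set Y := \sum_i y i.
have rR0 : 0 < r%:R :> R by rewrite ltr0n.
have in_A (F : T -> R) : (forall i, y i = 0 -> F i = 0) -> \sum_i F i = \sum_(i in A) F i.
  move=> F0; rewrite [RHS]big_mkcond /=; apply: eq_bigr => i _.
  by case: ifPn => // /yA/F0.
(* Centring at Y / r instead of Y / #|A| brings in r directly and allows an empty [A]. *)
have : 0 <= \sum_(i in A) (y i - Y / r%:R) ^+ 2.
  by apply: sumr_ge0 => i _; exact: sqr_ge0.
have -> : \sum_(i in A) (y i - Y / r%:R) ^+ 2 =
    \sum_(i in A) y i ^+ 2 - 2 * (Y / r%:R) * \sum_(i in A) y i + \sum_(i in A) (Y / r%:R) ^+ 2.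
  by rewrite mulr_sumr -sumrB -big_split /=; apply: eq_bigr => i _; ring.
rewrite sumr_const -(mulr_natr _ #|A|) -!in_A// => [|i ->]; last by rewrite expr0n.
rewrite -/Y => h.
have AR : #|A|%:R <= r%:R :> R by rewrite ler_nat.
have : (Y / r%:R) ^+ 2 * #|A|%:R <= r%:R^-1 * Y ^+ 2.
  rewrite (le_trans (ler_wpM2l (sqr_ge0 _) AR))// le_eqVlt; apply/orP; left.
  by apply/eqP; field; rewrite gt_eqF.
have E : 2 * (Y / r%:R) * Y = 2 * (r%:R^-1 * Y ^+ 2) by ring.
by move: h; rewrite E; lra.
Qed.

(** Clique-freeness in terms of vertex sets, ready to be applied to the support of a weight. *)
Definition cliques_le (r : nat) : Prop := forall A : {set T},
  (forall i j, i \in A -> j \in A -> i != j -> e i j) -> (#|A| <= r)%N.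

(* Moving all the weight of a vertex to a non-adjacent one with a larger weighted
   degree does not decrease the edge sum and shrinks the support; when no such
   move is left, the support is a clique. *)
Lemma motzkin_straus (r : nat) y : (0 < r)%N -> cliques_le r ->
  (forall i, 0 <= y i) -> edge_sum e y <= (1 - r%:R^-1) * (\sum_i y i) ^+ 2.
Proof.
move=> r0 hr.
have [m] := ubnP #|[set i | y i != 0]|; elim: m y => // m IH y; rewrite ltnS => ym y0.
have [|clq] := boolP [exists i, exists j, [&& y i != 0, y j != 0, i != j & ~~ e i j]].
  move=> /existsP[i /existsP[j /and4P[]]].
  wlog ij : i j / nbr_sum e y j <= nbr_sum e y i.
    move=> wl; have [/wl//|/ltW/wl h yi yj neq nij] := leP (nbr_sum e y j) (nbr_sum e y i).
    by apply: h => //; rewrite 1?eq_sym// e_sym.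
  move=> yi yj neq /negPf nij.
  pose z k := y k + y j * ((k == i)%:R - (k == j)%:R).
  have sz : \sum_k z k = \sum_k y k := sum_transfer y (y j) i j.
  have ez := edge_sum_transfer y (y j) i j; rewrite -/z in ez.
  have zj : z j = 0 by rewrite /z eqxx eq_sym (negPf neq) sub0r mulrN1 subrr.
  have zne k : k != j -> y k <= z k.
    by move=> /negPf kj; rewrite /z kj subr0 lerDl mulr_ge0.
  have z0 k : 0 <= z k.
    by have [->|/zne] := eqVneq k j; [rewrite zj | exact: le_trans].
  have : edge_sum e z <= (1 - r%:R^-1) * (\sum_i z i) ^+ 2.
    apply: IH => //; apply: leq_trans ym; apply: proper_card.
    apply/properP; split.
      apply/fintype.subsetP => k; rewrite !inE; apply: contra => /eqP yk.
      have [->|kj] := eqVneq k j; first exact/eqP.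
      have ki : k != i by apply: contraNneq yi => <-; exact/eqP.
      by rewrite /z yk (negPf kj) (negPf ki) subr0 mulr0 addr0.
    by exists j; rewrite !inE ?zj ?eqxx.
  rewrite sz; apply: le_trans.
  by rewrite ez nij mulr0 subr0 lerDl mulr_ge0 ?subr_ge0// mulr_ge0.
have {}clq i j : y i != 0 -> y j != 0 -> i != j -> e i j.
  move=> yi yj ij; apply: contraNT clq => nij.
  by apply/existsP; exists i; apply/existsP; exists j; rewrite yi yj ij.
(* On a clique all products of distinct weights occur, so only the diagonal of the squared total is
   missing. *)
have -> : edge_sum e y = (\sum_i y i) ^+ 2 - \sum_i y i ^+ 2.
  rewrite expr2 mulr_suml -sumrB; apply: eq_bigr => i _.
  rewrite expr2 -mulrBr; have [->|yi] := eqVneq (y i) 0; first by rewrite !mul0r.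
  congr (_ * _); rewrite /nbr_sum -(sum_delta i y) -sumrB; apply: eq_bigr => j _.
  have [->|ij] := eqVneq j i; first by rewrite e_irr mul0r mul1r subrr.
  rewrite mul0r subr0; have [->|yj] := eqVneq (y j) 0; first by rewrite mulr0.
  by rewrite clq ?mul1r// eq_sym.
rewrite mulrBl mul1r lerD2l lerN2.
apply: (@sqr_sum_le [set i | y i != 0]) => //.
  by apply: hr => i j; rewrite !inE; exact: clq.
by move=> i; rewrite inE negbK => /eqP.
Qed.

Lemma nbr_sum1 i : nbr_sum e (fun=> 1) i = #|[set j | e i j]|%:R :> R.
Proof.
rewrite /nbr_sum; under eq_bigr do rewrite mulr1.
rewrite -natr_sum -sum1_card [in RHS]big_mkcond /=; congr _%:R; apply: eq_bigr => j _.
by rewrite inE; case: (e i j).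
Qed.

(** * Graphs whose uniform weight attains the Motzkin-Straus bound *)

Section Extremal.
Variable r : nat.
Hypotheses (r0 : (0 < r)%N) (hr : cliques_le r).
Hypothesis ext : edge_sum e (fun=> 1) = (1 - r%:R^-1) * #|T|%:R ^+ 2 :> R.

(** The weight 1 + v is nonnegative with the same total as the uniform one, so its edge sum cannot
    exceed the extremal value. *)
Let edge_sum_max (v : T -> R) : (forall k, -1 <= v k) -> \sum_k v k = 0 ->
  2 * (\sum_k v k * nbr_sum e (fun=> 1) k) + edge_sum e v <= 0.
Proof.
move=> v1 sv.
have : edge_sum e (fun k => 1 + v k) <= (1 - r%:R^-1) * (\sum_i (1 + v i)) ^+ 2.
  by apply: motzkin_straus => // i; rewrite -lerBlDl sub0r.
rewrite big_split /= sv addr0 sumr_const -ext edge_sumD; lra.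
Qed.

(* The uniform weight perturbed by half a unit from b to a: the degrees being
   integers, the resulting bound deg a - deg b <= 1/2 suffices. *)
Lemma extremal_regular i j : #|[set k | e i k]| = #|[set k | e j k]|.
Proof.
suff le (a b : T) : (#|[set k | e a k]| <= #|[set k | e b k]|)%N.
  by apply/eqP; rewrite eqn_leq !le.
rewrite -ltnS -(ltr_nat R) -natr1 -!nbr_sum1.
have := edge_sum_transfer (fun=> 1) 2^-1 a b.
have := @motzkin_straus r (fun k => 1 + 2^-1 * ((k == a)%:R - (k == b)%:R)) r0 hr.
rewrite sum_transfer sumr_const -ext => H E.
have /H : forall k, 0 <= 1 + 2^-1 * ((k == a)%:R - (k == b)%:R) :> R.
  by move=> k; do 2!case: (_ == _); rewrite /=; lra.
by rewrite E; case: (e a b); rewrite /= expr2; lra.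
Qed.

(** If i and j were adjacent, moving the unit weight of k in halves to i and j would have zero first
    variation, by regularity, and second variation 1/2 from the edge ij alone, against
    maximality. *)
Lemma extremal_nonadj_trans i j k : ~~ e i k -> ~~ e j k -> ~~ e i j.
Proof.
move=> /negPf ik /negPf jk; apply/negP => ij.
have neq : i != j by apply: contraTneq ij => ->; rewrite e_irr.
pose v l : R := 2^-1 * (l == i)%:R + 2^-1 * (l == j)%:R - (l == k)%:R.
have sumv (F : T -> R) : \sum_l v l * F l = 2^-1 * F i + 2^-1 * F j - F k.
  rewrite -(sum_delta i F) -(sum_delta j F) -(sum_delta k F) !mulr_sumr.
  rewrite -big_split -sumrB /=; apply: eq_bigr => l _; rewrite /v; ring.
have nbrv l : nbr_sum e v l = 2^-1 * (e l i)%:R + 2^-1 * (e l j)%:R - (e l k)%:R.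
  by rewrite /nbr_sum; under eq_bigr do rewrite mulrC; rewrite sumv.
have : 2 * (\sum_k v k * nbr_sum e (fun=> 1) k) + edge_sum e v <= 0.
  apply: edge_sum_max => [l|].
    by rewrite /v; do 3!case: (_ == _); rewrite /=; lra.
  have := sumv (fun=> 1); under eq_bigr do rewrite mulr1.
  by move=> ->; lra.
rewrite sumv !nbr_sum1 (extremal_regular j i) (extremal_regular k i) {1}/edge_sum sumv.
rewrite !nbrv !e_irr ik jk (e_sym k i) (e_sym k j) (e_sym j i) ik jk ij /=.
by lra.
Qed.

(** By regularity [ext] says that every degree is (1 - 1/r) #|T|; the complement of a neighbourhood
    has the remaining #|T| / r vertices. *)
Lemma extremal_class_card i : (#|[set j | ~~ e i j]| * r)%N = #|T|.
Proof.
have T0 : (0 < #|T|)%N by apply/card_gt0P; exists i.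
have deg : edge_sum e (fun=> 1) = #|[set j | e i j]|%:R * #|T|%:R :> R.
  rewrite /edge_sum; under eq_bigr do rewrite mul1r nbr_sum1 (extremal_regular _ i).
  by rewrite sumr_const mulr_natr.
have cN : [set j | ~~ e i j] = ~: [set j | e i j]%SET by apply/finset.setP => j; rewrite !inE.
have := cardsC [set j | e i j]%SET; rewrite -cN => h.
have TR0 : 0 < #|T|%:R :> R by rewrite ltr0n.
have rR0 : 0 < r%:R :> R by rewrite ltr0n.
apply/eqP; rewrite -(eqr_nat R) natrM; apply/eqP.
have hR : #|[set j | e i j]|%:R + #|[set j | ~~ e i j]|%:R = #|T|%:R :> R.
  by rewrite -natrD h.
move: ext; rewrite deg expr2 mulrA => /(mulIf (lt0r_neq0 TR0)) hd.
have -> : #|[set j | ~~ e i j]|%:R = r%:R^-1 * #|T|%:R :> R by move: hd hR; lra.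
by field; rewrite gt_eqF.
Qed.

Lemma extremal_partition : (0 < #|T|)%N -> exists part : T -> 'I_r,
  (forall i j, e i j = (part i != part j)) /\
  (forall c, (#|[set i | part i == c]| * r)%N = #|T|).
Proof.
move=> /card_gt0P[i0 _].
pose N i := [set j | ~~ e i j]%SET.
have N_refl i : i \in N i by rewrite inE e_irr.
have NE i j : (N i == N j) = ~~ e i j.
  apply/eqP/idP => [Nij|nij]; first by have := N_refl j; rewrite -Nij inE.
  apply/finset.setP => k; rewrite !inE; apply/idP/idP => nk.
    by apply: (@extremal_nonadj_trans _ _ i); rewrite e_sym// e_sym.
  by apply: (@extremal_nonadj_trans _ _ j); rewrite // e_sym.
pose P := equivalence_partition (fun i j => ~~ e i j) [set: T]%SET.
have NP i : N i \in P by apply/imsetP; exists i => //; apply/finset.setP => j; rewrite !inE.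
have PN B : B \in P -> exists i, B = N i.
  by case/imsetP => i _ ->; exists i; apply/finset.setP => j; rewrite !inE.
have partP : finset.partition P [set: T]%SET.
  apply/equivalence_partitionP => i j k _ _ _; split; first by rewrite e_irr.
  by rewrite -!NE => /eqP ->.
(* All classes have the size of [N i0], and r times that size is #|T|; cancelling this positive size
   leaves r classes. *)
have cardP : #|P| = r.
  have cN B : B \in P -> #|B| = #|N i0|.
    case/PN => i ->; apply/eqP; rewrite -(eqn_pmul2r r0).
    by rewrite !extremal_class_card.
  have := card_uniform_partition cN partP.
  rewrite cardsT -(extremal_class_card i0) mulnC => /eqP.
  by rewrite eqn_pmul2r => [/eqP|]; last by apply/card_gt0P; exists i0.
exists (fun i => cast_ord cardP (enum_rank_in (NP i0) (N i))).
have partE i j : (cast_ord cardP (enum_rank_in (NP i0) (N i)) ==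
    cast_ord cardP (enum_rank_in (NP i0) (N j))) = ~~ e i j.
  by rewrite (inj_eq (@cast_ord_inj _ _ _)) -NE (can_in_eq (enum_rankK_in (NP i0))).
split=> [i j|c]; first by rewrite partE negbK.
have [i Ei] := PN _ (enum_valP (cast_ord (esym cardP) c)).
have -> : c = cast_ord cardP (enum_rank_in (NP i0) (N i)).
  by rewrite -Ei enum_valK_in cast_ordKV.
rewrite -(extremal_class_card i); congr (#|pred_of_set _| * _)%N.
by apply/finset.setP => j; rewrite !inE partE e_sym.
Qed.

End Extremal.

End WeightedGraph.

(** * The power mean inequality *)

Lemma power_mean (R : realType) (I : finType) (A : {pred I}) (a : I -> R) (p : R) :
  1 <= p -> (forall i, 0 <= a i) ->
  \sum_(i in A) a i <= (\sum_(i in A) a i `^ p) `^ p^-1 * #|A|%:R `^ (1 - p^-1).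
Proof.
rewrite le_eqVlt => /predU1P[<- a0|p1 a0].
  rewrite invr1 subrr powRr0 mulr1 powRr1 ?sumr_ge0// => [|i _]; last exact: powR_ge0.
  by apply: ler_sum => i _; rewrite powRr1.
have p0 : 0 < p by exact: lt_trans p1.
set S := \sum_(i in A) a i `^ p; set N : R := #|A|%:R.
have S0 : 0 <= S by apply: sumr_ge0 => i _; exact: powR_ge0.
(* S = 0 is treated apart: the scale [t] below must be positive, since a power of it is cancelled at
   the end. *)
move: (S0); rewrite le_eqVlt => /predU1P[Sz|Sp].
  rewrite big1 ?mulr_ge0 ?powR_ge0// => i iA; apply/eqP.
  have /psumr_eq0P : \sum_(i in A) a i `^ p = 0 by [].
  move=> /(_ (fun i _ => powR_ge0 _ _)) /(_ i iA)/eqP.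
  by rewrite powR_eq0 => /andP[].
have Np : 0 < N.
  rewrite ltr0n lt0n; apply: contraTneq Sp => /card0_eq A0.
  by rewrite /S big_pred0// ltxx.
have q0 : 0 < 1 - p^-1 by rewrite subr_gt0 invf_lt1.
(* Young's inequality, scaled so that equality holds when every a i is t. *)
pose t := (S / N) `^ p^-1.
have t0 : 0 < t by rewrite powR_gt0// divr_gt0.
have tp : t `^ p = S / N by rewrite -powRrM mulVf ?gt_eqF// powRr1// divr_ge0// ltW.
have tpE : t `^ p = t * t `^ (p - 1).
  rewrite -{2}[t]powRr1 ?ltW// -powRD ?subrKC//.
  by rewrite (gt_eqF t0) implybT.
(* The exponent q conjugate to p satisfies (p - 1) q = p, so the second factor to the power q is t^p
   = S / N. *)
have young i : a i * t `^ (p - 1) <= a i `^ p / p + S / N * (1 - p^-1).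
  have := @conjugate_powR R (a i) (t `^ (p - 1)) p (1 - p^-1)^-1 (a0 i) (powR_ge0 _ _) p0.
  rewrite invr_gt0 invrK -powRrM => /(_ q0).
  have -> : (p - 1) / (1 - p^-1) = p by field; rewrite !gt_eqF// ?subr_gt0.
  by rewrite tp; apply; ring.
have SE : N * t * t `^ (p - 1) = S by rewrite -mulrA -tpE tp mulrC divfK// gt_eqF.
have : (\sum_(i in A) a i) * t `^ (p - 1) <= N * t * t `^ (p - 1).
  rewrite SE mulr_suml (le_trans (ler_sum _ (fun i _ => young i)))//.
  rewrite big_split /= -mulr_suml sumr_const -(mulr_natr _ #|A|) -/S -/N.
  by rewrite le_eqVlt; apply/orP; left; apply/eqP; field; rewrite !gt_eqF.
rewrite (ler_pM2r (powR_gt0 _ t0)) => /le_trans; apply.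
rewrite /t -(powR_inv1 (ltW Np)) powRM ?powR_ge0// -powRrM mulN1r.
rewrite mulrCA (ler_pM2l (powR_gt0 _ Sp)) powRD ?powRr1 ?(ltW Np)//.
by rewrite (gt_eqF Np) implybT.
Qed.

(** * From graphs and their spectral radius to edge sums *)

Section GraphForms.
Variables (R : realType) (n : nat) (G : graph n).

(** Swapping coordinates matches the adjacent pairs i < j with the pairs i > j; irreflexivity
    excludes the diagonal. *)
Lemma sum_edges (F : 'I_n -> 'I_n -> R) : (forall i j, F i j = F j i) ->
  2 * (\sum_(ij in edges G) F ij.1 ij.2) =
  \sum_(ij | adj G ij.1 ij.2) F ij.1 ij.2.
Proof.
move=> Fsym; rewrite [RHS](bigID (fun ij : 'I_n * 'I_n => (ij.1 < ij.2)%N)) /=.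
have -> : \sum_(ij in edges G) F ij.1 ij.2 =
    \sum_(ij | adj G ij.1 ij.2 && (ij.1 < ij.2)%N) F ij.1 ij.2.
  by apply: eq_bigl => ij; rewrite inE andbC.
rewrite mulr_natl mulr2n; congr (_ + _).
rewrite (reindex_inj (can_inj (@swap_pairK 'I_n 'I_n)))/=.
apply: eq_big => [[i j] /=|[i j] _ /=]; last exact: Fsym.
rewrite adj_sym -leqNgt [in RHS]leq_eqVlt val_eqE.
by have [->|_] := eqVneq i j; rewrite ?adj_irrefl.
Qed.

Lemma edge_sumE (y : 'I_n -> R) :
  edge_sum (adj G) y = \sum_(ij | adj G ij.1 ij.2) y ij.1 * y ij.2.
Proof.
rewrite /edge_sum /nbr_sum; under eq_bigr do rewrite mulr_sumr.
rewrite pair_bigA [RHS]big_mkcond; apply: eq_bigr => ij _ /=.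
by case: (adj _ _ _); rewrite ?mul1r// mul0r mulr0.
Qed.

Lemma edge_formE (x : 'rV[R]_n) : edge_form G x = edge_sum (adj G) (x ord0).
Proof.
rewrite edge_sumE /edge_form.
by rewrite (@sum_edges (fun i j => x ord0 i * x ord0 j))// => i j; rewrite mulrC.
Qed.

Lemma num_edgesE : 2 * (num_edges G)%:R = #|[pred ij | adj G ij.1 ij.2]|%:R :> R.
Proof.
by rewrite /num_edges -!sum1_card !natr_sum (@sum_edges (fun _ _ => 1)).
Qed.

Lemma edge_sum1 : edge_sum (adj G) (fun=> 1) = 2 * (num_edges G)%:R :> R.
Proof.
rewrite edge_sumE num_edgesE -sum1_card natr_sum.
by apply: eq_bigr => ij _; rewrite mulr1.
Qed.

(** The assumption [0 <= b] covers an empty sphere, where [sup] takes the value 0. *)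
Lemma p_spectral_radius_le (p b : R) : 0 <= b ->
  (forall x, p_sphere p x -> edge_form G x <= b) -> p_spectral_radius p G <= b.
Proof.
move=> b0 hb; rewrite /p_spectral_radius.
have [->|/set0P S0] := eqVneq (image (p_sphere p) (edge_form G)) set0.
  by rewrite sup0.
by apply: ge_sup => // _ [x xS <-]; exact: hb.
Qed.

Lemma clique_free_cliques_le (r : nat) :
  free_of (complete r.+1) G -> cliques_le (adj G) r.
Proof.
move=> hG A clq; rewrite leqNgt; apply/negP => rA; apply: hG.
exists (fun i => enum_val (widen_ord rA i)); split.
  by move=> i j /enum_val_inj /(congr1 val) /= /val_inj.
move=> i j /= ij; apply: clq; rewrite ?enum_valP//.
by apply: contra ij => /eqP /enum_val_inj /(congr1 val) /= /val_inj ->.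
Qed.

Lemma edge_form_le (p c : R) (x : 'rV[R]_n) : 1 <= p -> p_sphere p x ->
  (forall y : 'I_n -> R, (forall i, 0 <= y i) -> \sum_i y i = 1 ->
    edge_sum (adj G) y <= c) ->
  edge_form G x <= c `^ p^-1 * (2 * (num_edges G)%:R) `^ (1 - p^-1).
Proof.
move=> p1 xS hc; have p0 : 0 < p by exact: lt_le_trans p1.
rewrite edge_formE edge_sumE num_edgesE.
apply: (le_trans (y := \sum_(ij | adj G ij.1 ij.2) `|x ord0 ij.1| * `|x ord0 ij.2|)).
  by apply: ler_sum => ij _; rewrite -normrM ler_norm.
apply: (le_trans (@power_mean _ _ [pred ij | adj G ij.1 ij.2]
  (fun ij => `|x ord0 ij.1| * `|x ord0 ij.2|) p p1 _)).
  by move=> ij; rewrite mulr_ge0.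
rewrite ler_wpM2r ?powR_ge0//.
have -> : \sum_(ij in [pred ij | adj G ij.1 ij.2]) (`|x ord0 ij.1| * `|x ord0 ij.2|) `^ p =
    edge_sum (adj G) (fun i => `|x ord0 i| `^ p).
  by rewrite edge_sumE; apply: eq_bigr => ij _; rewrite powRM.
have es0 : 0 <= edge_sum (adj G) (fun i => `|x ord0 i| `^ p).
  by rewrite edge_sumE sumr_ge0// => ij _; rewrite mulr_ge0// powR_ge0.
have le : edge_sum (adj G) (fun i => `|x ord0 i| `^ p) <= c.
  by apply: hc => // i; exact: powR_ge0.
apply: ge0_ler_powR => //; first by rewrite invr_ge0 ltW.
by rewrite nnegrE (le_trans es0).
Qed.

Lemma edge_sum_turan (r : nat) : (0 < r)%N -> (r %| n)%N -> is_turan r G ->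
  edge_sum (adj G) (fun=> 1) = (1 - r%:R^-1) * n%:R ^+ 2 :> R.
Proof.
move=> r0 rn [part [adjE cardE]].
(* Floor and ceiling of n / r agree when r divides n, as r - 1 < r. *)
have card_class c : #|[set i | part i == c]%SET| = (n %/ r)%N.
  case: (cardE c) => -> //; rewrite divnDl// (@divn_small r.-1) ?addn0//.
  by rewrite prednK.
have rR0 : r%:R != 0 :> R by rewrite pnatr_eq0 -lt0n.
have nE : n%:R = r%:R * (n %/ r)%:R :> R by rewrite -natrM mulnC divnK.
rewrite /edge_sum (eq_bigr (fun=> n%:R - (n %/ r)%:R)) => [|i _].
  rewrite sumr_const card_ord -[LHS]mulr_natr nE; field; exact: rR0.
rewrite mul1r nbr_sum1 -(card_class (part i)).
have -> : [set j | adj G i j]%SET = ~: [set j | part j == part i]%SET.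
  by apply/finset.setP => j; rewrite !inE adjE eq_sym.
have := cardsC [set j | part j == part i]%SET.
by rewrite card_ord => /(congr1 (fun m => m%:R : R)) <-; rewrite natrD addrC addKr.
Qed.

Lemma extremal_is_turan (r : nat) : (0 < r)%N -> (0 < n)%N -> cliques_le (adj G) r ->
  edge_sum (adj G) (fun=> 1) = (1 - r%:R^-1) * n%:R ^+ 2 :> R ->
  (r %| n)%N /\ is_turan r G.
Proof.
move=> r0 n0 hr ext.
have [||part [partE cardE]] :=
  @extremal_partition R _ (adj G) (@adj_sym _ G) (@adj_irrefl _ G) r r0 hr.
- by rewrite card_ord.
- by rewrite card_ord.
rewrite card_ord in cardE.
split; first by rewrite -(cardE (Ordinal r0)) dvdn_mull.
by exists part; split => // c; left; rewrite -[X in (X %/ r)%N](cardE c) mulnK.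
Qed.

Lemma edge_form_le_p_spectral_radius (p : R) (x : 'rV[R]_n) : (0 < n)%N -> 1 <= p ->
  p_sphere p x -> edge_form G x <= p_spectral_radius p G.
Proof. by move=> n0 p1 xS; have [y _ [<- ]] := p_spectral_radius_max G n0 p1; apply. Qed.

End GraphForms.

(** * The two bounds and the equality case *)

Theorem theorem3 (R : realType) (r n : nat) (p : R) (G : graph n)
    (hr : (2 <= r)%N) (hp : 1 <= p) (hG : free_of (complete r.+1) G) :
  p_spectral_radius p G
    <= (1 - r%:R^-1) `^ p^-1 * (2 * (num_edges G)%:R) `^ (1 - p^-1) /\
  p_spectral_radius p G <= (1 - r%:R^-1) * n%:R `^ (2 - 2 / p) /\
  (1 < p ->
    (p_spectral_radius p G = (1 - r%:R^-1) * n%:R `^ (2 - 2 / p) <->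
     (r %| n)%N /\ is_turan r G)).
Proof.
have r0 : (0 < r)%N by apply: leq_trans hr.
have p0 : 0 < p by exact: lt_le_trans hp.
have hcl := clique_free_cliques_le hG.
set c : R := 1 - r%:R^-1.
have c0 : 0 < c by rewrite subr_gt0 invf_lt1 ?ltr0n// ltr1n.
have straus (y : 'I_n -> R) : (forall i, 0 <= y i) ->
    edge_sum (adj G) y <= c * (\sum_i y i) ^+ 2.
  by apply: motzkin_straus => //; [exact: adj_sym | exact: adj_irrefl].
have bound1 : p_spectral_radius p G <= c `^ p^-1 * (2 * (num_edges G)%:R) `^ (1 - p^-1).
  apply: p_spectral_radius_le => [|x xS]; first by rewrite mulr_ge0 ?powR_ge0.
  apply: edge_form_le => // y y0 y1.
  by have := straus y y0; rewrite y1 expr1n mulr1.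
have turan : 2 * (num_edges G)%:R <= c * n%:R ^+ 2.
  by have := straus (fun=> 1) (fun=> ler01); rewrite edge_sum1 sumr_const card_ord.
have q0 : 0 <= 1 - p^-1 by rewrite subr_ge0 invf_le1.
(* Inserting the bound [turan] for 2e into the first bound yields exactly the second: the exponents
   of c add up to 1. *)
have rhsE : c `^ p^-1 * (c * n%:R ^+ 2) `^ (1 - p^-1) = c * n%:R `^ (2 - 2 / p).
  rewrite powRM ?sqr_ge0 1?ltW// mulrA -powRD; last by rewrite (gt_eqF c0) implybT.
  rewrite subrKC powRr1 1?ltW// -powR_mulrn// -powRrM mulrBr mulr1//.
split=> //; split=> [|p1].
  apply: le_trans bound1 _; rewrite -rhsE ler_wpM2l ?powR_ge0//.
  by apply: ge0_ler_powR; rewrite ?nnegrE ?mulr_ge0// ?sqr_ge0 ?(ltW c0).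
have q1 : 0 < 1 - p^-1 by rewrite subr_gt0 invf_lt1.
(* For n = 0 both sides of the equivalence hold: the sphere is empty, so the radius is 0, and so is
   the right-hand side because 2 - 2/p > 0. *)
case: (posnP n) => [n0|n0].
  subst n; split=> _.
    split; first exact: dvdn0.
    exists (fun=> Ordinal r0); split=> [[]//|d]; left.
    by rewrite div0n; apply: eq_card0 => -[].
  have S0 : p_sphere p = set0 :> set 'rV[R]_0.
    rewrite -subset0 => x; rewrite /p_sphere /= big_ord0 => /esym/eqP.
    by rewrite oner_eq0.
  rewrite /p_spectral_radius S0 image_set0 sup0 powR0 ?mulr0//.
  by rewrite gt_eqF// -[X in X - _]mulr1 -mulrBr mulr_gt0.
split=> [eq|[rn tG]].
  apply: (@extremal_is_turan R) => //; rewrite edge_sum1.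
  (* A strict inequality in [turan] would survive the power 1 - 1/p > 0 and put [bound1] strictly
     below the assumed value. *)
  apply/eqP; rewrite eq_le turan /= leNgt; apply/negP => lt.
  move: bound1; rewrite eq -rhsE leNgt ltr_pM2l ?powR_gt0// => /negP; apply.
  by apply: gt0_ltr_powR; rewrite ?nnegrE ?mulr_ge0// ?sqr_ge0 ?(ltW c0).
apply/eqP; rewrite eq_le; apply/andP; split.
  rewrite -rhsE -(@edge_sum_turan R _ _ _ r0 rn tG) edge_sum1.
  exact: bound1.
have nR0 : 0 < n%:R :> R by rewrite ltr0n.
(* The constant vector on the sphere; its edge form is n^(-2/p) times the edge sum of the uniform
   weight. *)
pose x : 'rV[R]_n := const_mx (n%:R `^ (- p^-1)).
have xS : p_sphere p x.
  rewrite /p_sphere /=; under eq_bigr do rewrite mxE ger0_norm ?powR_ge0//.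
  rewrite sumr_const card_ord -powRrM mulNr mulVf ?gt_eqF// powR_inv1//.
  by rewrite -[LHS]mulr_natr mulVf ?gt_eqF.
apply: le_trans (edge_form_le_p_spectral_radius G n0 hp xS).
rewrite edge_formE.
have -> : edge_sum (adj G) (x ord0) =
    edge_sum (adj G) (fun=> n%:R `^ (- p^-1) * 1).
  by rewrite !edge_sumE; apply: eq_bigr => ij _; rewrite !mxE mulr1.
rewrite edge_sumZ (edge_sum_turan R r0 rn tG) mulrCA ler_pM2l//.
rewrite -!powR_mulrn ?powR_ge0// -powRrM -powRD ?(gt_eqF nR0) ?implybT//.
by rewrite mulNr addrC [_^-1 * _]mulrC.
Qed.
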